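(* Consider the system $\dot x_1 = x_2$, $\dot x_2 = u + w$ with state $x=(x_1,x_2)\in\mathbb{R}^2$, control input $u\in[u_{lb},u_{ub}]\subset\mathbb{R}$ and disturbance $w\in[-w_{\max},w_{\max}]$, together with bounds $l_{lb},l_{ub}$, their common derivative $\dot l$, the constants $\ddot l_{\max}$ and $a_{\max}>0$, and the set $\mathcal{S}^{res}_c(t)$, all as specified in the context; in particular $$\max\{u_{lb}+w_{\max}+\ddot l_{\max},\,-u_{ub}+w_{\max}+\ddot l_{\max}\}\le -a_{\max}<0 .$$ Suppose $l_{ub}(t_0)-l_{lb}(t_0)>0$, $x(t_0)\in\mathcal{S}^{res}_c(t_0)$, and the constants $\alpha_{ub},\alpha_{lb}\in\mathbb{R}_{>0}$ satisfy $$\alpha_{ub}=\alpha_{lb}\ \ge\ 2w_{\max}\sqrt{\frac{2}{(l_{ub}(t_0)-l_{lb}(t_0))\,a_{\max}}}.$$ Define $$\Phi_{lb}(t,x) = -\frac{a_{\max}}{|x_2-\dot l|}\,\alpha_{lb}\left(x_1-l_{lb}+\frac{|x_2-\dot l|(x_2-\dot l)}{2a_{\max}}\right)-\operatorname{sgn}(x_2-\dot l)\,a_{\max}+w_{\max}+\ddot l,$$ $$\Phi_{ub}(t,x) = \frac{a_{\max}}{|x_2-\dot l|}\,\alpha_{ub}\left(-x_1+l_{ub}-\frac{|x_2-\dot l|(x_2-\dot l)}{2a_{\max}}\right)-\operatorname{sgn}(x_2-\dot l)\,a_{\max}-w_{\max}+\ddot l,$$ where $l_{lb},l_{ub},\dot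 l,\ddot l$ are evaluated at $t$, and $$U_c(t,x)=\{u\in[u_{lb},u_{ub}] \mid \Phi_{lb}(t,x)\le u\le \Phi_{ub}(t,x)\},$$ where for $x_2=\dot l(t)$ the two inequalities are understood after multiplication by $|x_2-\dot l|$ (see the context), so that $U_c(t,x)=[u_{lb},u_{ub}]$ if $x_2=\dot l(t)$ and $x\in\mathcal{S}^{res}_c(t)$. Then: (i) for all $t\in[t_0,\infty)$ and all $x\in\mathcal{S}^{res}_c(t)$, the set $U_c(t,x)$ is non-empty; (ii) any control law $u(t,x)$ that is locally Lipschitz continuous in $x$ and piecewise continuous in $t$ and satisfies $u(t,x)\in U_c(t,x)$ for all $t\in[t_0,\infty)$, $x\in\mathcal{S}^{res}_c(t)$, renders $\mathcal{S}^{res}_c(t)$ forward invariant under the input constraints $u\in[u_{lb},u_{ub}]$ and disturbances $|w|\le w_{\max}$.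
   Context: Setting. Let $t_0\in\mathbb{R}$, $w_{\max}\ge 0$, $u_{lb}\le u_{ub}$. The functions $l_{ub},l_{lb}:[t_0,\infty)\to\mathbb{R}$ are twice differentiable, with $l_{ub}(t)\ge l_{lb}(t)$ and $\dot l_{ub}(t)=\dot l_{lb}(t)=:\dot l(t)$ for all $t$ (so $l_{ub}-l_{lb}$ is constant in time), and $|\ddot l(t)|\le\ddot l_{\max}$ for all $t$. The constant $a_{\max}>0$ is such that $\max\{u_{lb}+w_{\max}+\ddot l_{\max},\,-u_{ub}+w_{\max}+\ddot l_{\max}\}\le -a_{\max}$. (The system $\dot x_1=x_2$, $\dot x_2=u+w$ arises from $\dot x_2=f(x_1,x_2)+g(x_1,x_2)(\mu+\nu)$, $g\neq 0$, via $\mu=g^{-1}(u-f)$ and $w=g\nu$.) Constraint functions: $h_{ub}(t,x)=x_1-l_{ub}(t)$ and $h_{lb}(t,x)=-x_1+l_{lb}(t)$. Barrier functions: $$H_{ub}(t,x)=x_1-l_{ub}(t)+\frac{|x_2-\dot l(t)|(x_2-\dot l(t))}{2a_{\max}},\qquad H_{lb}(t,x)=-x_1+l_{lb}(t)-\frac{|x_2-\dot l(t)|(x_2-\dot l(t))}{2a_{\max}}.$$ Safe set: $$\mathcal{S}^{res}_c(t)=\{x\in\mathbb{R}^2\mid H_{ub}(t,x)\le 0,\ h_{ub}(t,x)\le 0,\ H_{lb}(t,x)\le 0,\ h_{lb}(t,x)\le 0\}.$$ Convention at $x_2=\dot l(t)$: there $\Phi_{lb},\Phi_{ub}$ are undefined.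 The condition $u\le\Phi_{ub}$ stands for $\max_{|w|\le w_{\max}}\dot H_{ub}(t,x,u,w)\le\alpha_{ub}\cdot(-H_{ub}(t,x))$, and $\Phi_{lb}\le u$ stands for $\max_{|w|\le w_{\max}}\dot H_{lb}(t,x,u,w)\le\alpha_{lb}\cdot(-H_{lb}(t,x))$, where $$\dot H_{ub}(t,x,u,w)=x_2-\dot l+\frac{|x_2-\dot l|(u+w-\ddot l)}{a_{\max}},\qquad \dot H_{lb}(t,x,u,w)=-x_2+\dot l+\frac{|x_2-\dot l|(-u-w+\ddot l)}{a_{\max}}.$$ When $x_2=\dot l(t)$ and $x\in\mathcal{S}^{res}_c(t)$ these conditions hold for every $u$. Control laws are functions $u:[t_0,\infty)\times\mathbb{R}^2\to\mathbb{R}$; ''locally Lipschitz in $x$ and piecewise continuous in $t$'' is meant in the usual ODE sense (Lipschitz constants uniform for $t$ in compact intervals). Forward invariance: $u$ renders $\mathcal{S}^{res}_c(t)$ forward invariant if, for every measurable disturbance signal $w:[t_0,\infty)\to[-w_{\max},w_{\max}]$, every (Carathéodory) solution of $\dot x_1=x_2$, $\dot x_2=u(t,x)+w(t)$ with $x(t_0)\in\mathcal{S}^{res}_c(t_0)$ satisfies $x(t)\in\mathcal{S}^{res}_c(t)$ for all $t\ge t_0$ in its interval of existence. *)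

(* Defs.v *)
From mathcomp Require Import all_boot all_order all_algebra.
From mathcomp Require Export all_classical all_reals all_analysis.
Export numFieldNormedType.Exports.

Set Implicit Arguments.
Unset Strict Implicit.
Unset Printing Implicit Defensive.

Import Order.TTheory GRing.Theory Num.Theory.

Local Open Scope classical_set_scope.
Local Open Scope ring_scope.

(* Derivative relative to the domain [D]: on D = [t0, +oo[ it is one-sided at
   t0, so no behaviour of [f] before t0 is involved. *)
Definition has_derivative_within {R : realType} (D : set R) (f : R -> R)
    (t d : R) : Prop :=
  (f s - f t) / (s - t) @[s --> within D t^'] --> d.

Definition absolutely_continuous {R : realType} (a b : R) (f : R -> R) : Prop :=
  forall e : R, 0 < e -> exists2 d : R, 0 < d &
    forall (n : nat) (p q : 'I_n -> R),
      (forall i, [/\ a <= p i, p i <= q i & q i <= b]) ->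
      trivIset setT (fun i => `]p i, q i[%classic) ->
      \sum_(i < n) (q i - p i) < d ->
      \sum_(i < n) `|f (q i) - f (p i)| < e.

(* Lebesgue (not merely Borel) measurability of a real function on [D]: the
   domain carries the Caratheodory sigma-algebra of the Lebesgue outer measure,
   on which [completed_lebesgue_measure] lives. *)
Definition lebesgue_measurable_fun {R : realType} (D : set R) (f : R -> R) :
    Prop :=
  measurable_fun
    (D : set (caratheodory_type ((wlength (@idfun R))^*)%mu))
    (f : caratheodory_type ((wlength (@idfun R))^*)%mu -> R).

(* Finitely many exceptional times in each [t0, T], and all one-sided limits
   exist in R, also at the exceptional times. *)
Definition piecewise_continuous_from {R : realType} (t0 : R) (f : R -> R) :
    Prop :=
  forall T : R, t0 <= T ->
  [/\ exists s : seq R,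
        forall t, t0 < t < T -> t \notin s -> {for t, continuous f},
      forall t, t0 <= t < T -> cvg (f s @[s --> t^'+])
    & forall t, t0 < t <= T -> cvg (f s @[s --> t^'-])].

(* Local Lipschitz continuity in the state, with a constant uniform in the time
   over compact intervals. *)
Definition locally_lipschitz_state {R : realType} (t0 : R)
    (u : R -> R * R -> R) : Prop :=
  forall (T : R) (z : R * R), t0 <= T ->
  exists r L : R, 0 < r /\
    forall t, t0 <= t <= T -> L.-lipschitz_(ball z r) (u t).

(* Caratheodory solution of x1' = x2, x2' = u(t, x) + w(t) on the interval [J].
   Values of [x] outside [J] are irrelevant: the (two-sided) derivatives are
   only required almost everywhere, hence effectively at interior points. *)
Definition caratheodory_solution {R : realType} (u : R -> R * R -> R)
    (w : R -> R) (J : set R) (x : R -> R * R) : Prop :=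
  [/\ forall a b, a <= b -> J a -> J b ->
        absolutely_continuous a b (fun t => (x t).1) /\
        absolutely_continuous a b (fun t => (x t).2)
    & {ae (@lebesgue_measure R), forall t, J t ->
        is_derive t 1 (fun s => (x s).1) (x t).2 /\
        is_derive t 1 (fun s => (x s).2) (u t (x t) + w t)}].

(* [J] ranges over all the intervals with first point t0 (bounded or not, right
   end included or not). *)
Definition forward_invariant {R : realType} (t0 wmax : R)
    (u : R -> R * R -> R) (S : R -> set (R * R)) : Prop :=
  forall w : R -> R,
  lebesgue_measurable_fun `[t0, +oo[ w ->
  (forall t, t0 <= t -> - wmax <= w t <= wmax) ->
  forall (J : set R) (x : R -> R * R),
  is_interval J -> J t0 -> J `<=` `[t0, +oo[ ->
  caratheodory_solution u w J x ->
  S t0 (x t0) ->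
  forall t, J t -> S t (x t).

Definition h_ub {R : realType} (lub : R -> R) (t : R) (x : R * R) : R :=
  x.1 - lub t.

Definition h_lb {R : realType} (llb : R -> R) (t : R) (x : R * R) : R :=
  - x.1 + llb t.

(* From here on [dl] and [ddl] stand for the first and second derivatives of
   the bounds [lub] and [llb]. *)
Definition H_ub {R : realType} (amax : R) (lub dl : R -> R) (t : R)
    (x : R * R) : R :=
  x.1 - lub t + `|x.2 - dl t| * (x.2 - dl t) / (2 * amax).

Definition H_lb {R : realType} (amax : R) (llb dl : R -> R) (t : R)
    (x : R * R) : R :=
  - x.1 + llb t - `|x.2 - dl t| * (x.2 - dl t) / (2 * amax).

Definition safe_set {R : realType} (amax : R) (lub llb dl : R -> R) (t : R) :
    set (R * R) :=
  [set x | [/\ H_ub amax lub dl t x <= 0, h_ub lub t x <= 0,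
               H_lb amax llb dl t x <= 0 & h_lb llb t x <= 0]].

Definition Hdot_ub {R : realType} (amax : R) (dl ddl : R -> R) (t : R)
    (x : R * R) (u w : R) : R :=
  x.2 - dl t + `|x.2 - dl t| * (u + w - ddl t) / amax.

Definition Hdot_lb {R : realType} (amax : R) (dl ddl : R -> R) (t : R)
    (x : R * R) (u w : R) : R :=
  - x.2 + dl t + `|x.2 - dl t| * (- u - w + ddl t) / amax.

(* Meaningful only for x.2 != dl t (division by zero otherwise). *)
Definition Phi_lb {R : realType} (amax wmax alpha : R) (llb dl ddl : R -> R)
    (t : R) (x : R * R) : R :=
  - (amax / `|x.2 - dl t|) * alpha *
      (x.1 - llb t + `|x.2 - dl t| * (x.2 - dl t) / (2 * amax))
  - Num.sg (x.2 - dl t) * amax + wmax + ddl t.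

Definition Phi_ub {R : realType} (amax wmax alpha : R) (lub dl ddl : R -> R)
    (t : R) (x : R * R) : R :=
  (amax / `|x.2 - dl t|) * alpha *
      (- x.1 + lub t - `|x.2 - dl t| * (x.2 - dl t) / (2 * amax))
  - Num.sg (x.2 - dl t) * amax - wmax + ddl t.

(* Where Phi_lb and Phi_ub are undefined, they are replaced by the conditions
   they stand for:  max_{|w| <= wmax} Hdot <= alpha * (- H). *)
Definition U_c {R : realType} (amax wmax ulb uub alpha_ub alpha_lb : R)
    (lub llb dl ddl : R -> R) (t : R) (x : R * R) : set R :=
  [set u | [/\ ulb <= u <= uub,
    x.2 != dl t ->
      Phi_lb amax wmax alpha_lb llb dl ddl t x <= u
        <= Phi_ub amax wmax alpha_ub lub dl ddl t x
  & x.2 = dl t -> forall w, `|w| <= wmax ->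
      Hdot_lb amax dl ddl t x u w <= alpha_lb * - H_lb amax llb dl t x /\
      Hdot_ub amax dl ddl t x u w <= alpha_ub * - H_ub amax lub dl t x]].

(* Main.v *)
(* With p = x1 - llb and v = x2 - dl the dynamics become p' = v, v' = u + w - ddl,
   and, as lub - llb is a constant g, the safe set becomes the fixed set
     p - g + max(v, 0)^2 / (2 a) <= 0,   - p + max(-v, 0)^2 / (2 a) <= 0.
   The sum f of the squared positive parts of these two C^1 functions vanishes
   exactly on that set.  On the part v > 0 of the first boundary the control
   condition forces u <= - a - wmax + ddl, i.e. v' <= - a, so that the first
   function does not increase; a point outside the set lies within C sqrt f of such
   a boundary point, so the Lipschitz bound on u gives f' <= k f almost everywhere.
   A Gronwall argument after the last zero of f shows that f stays zero.
   For non-emptiness, |v| <= sqrt (2 a g) on the safe set, and the lower bound on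
   alpha is what makes Phi_lb <= Phi_ub for all such v. *)

Require Import Defs.
From mathcomp Require Import all_boot all_order all_algebra.
From mathcomp Require Import ring lra.
From mathcomp Require Import all_classical all_reals all_analysis measurable_realfun.
Import Order.TTheory GRing.Theory Num.Theory.
Import numFieldNormedType.Exports.
Local Open Scope classical_set_scope.
Local Open Scope ring_scope.

(** * Absolutely continuous functions *)

Lemma is_derive_near {R : realType} (f : R -> R) (t d : R) :
  is_derive t 1 f d -> forall e, 0 < e ->
  \forall s \near t, `|f s - f t - d * (s - t)| <= e * `|s - t|.
Proof.
move=> [df dE] e e0.
have cv : (h^-1 *: ((f \o shift t) (h *: (1 : R)) - f t)) @[h --> 0^'] --> d.
  by rewrite -dE.
have /cvgrPdist_le/(_ e e0) := cv.
move=> /nbhs_ballP[r /= r0 rP]; apply/nbhs_ballP; exists r => //= s.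
rewrite /ball/= => ts.
have [->|st] := eqVneq s t; first by rewrite !subrr mulr0 subr0 !normr0 mulr0.
have st0 : s - t != 0 by rewrite subr_eq0.
have := rP (s - t); rewrite /ball/= sub0r normrN distrC => /(_ ts st0).
rewrite /GRing.scale/= mulr1 subrK => H.
have -> : f s - f t - d * (s - t) = - ((d - (s - t)^-1 * (f s - f t)) * (s - t)).
  by field.
by rewrite normrN normrM [in leRHS]distrC ler_wpM2r.
Qed.

(** Outer regularity makes the part of [G] outside a measurable null set [A] small, and adding [A]
    back costs no measure. *)
Lemma negligible_open_cover {R : realType} (N : set R) (e : R) :
  (@lebesgue_measure R).-negligible N -> 0 < e ->
  exists G : set R, [/\ open G, N `<=` G & (lebesgue_measure G < e%:E)%E].
Proof.
move=> [A [mA A0 NA]] e0.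
have [|G [oG AG mG]] := lebesgue_regularity_outer mA _ e0.
  by rewrite [X in (X < _)%E]A0 ltry.
exists G; split => //; first exact: subset_trans NA AG.
apply: le_lt_trans mG.
have mG' : measurable G by exact: open_measurable.
rewrite -[X in (lebesgue_measure X <= _)%E](setDUK AG).
apply: le_trans (measureU2 _ _ _) _ => //; first exact: measurableD.
by rewrite [X in (X + _)%E]A0 add0e.
Qed.

(** Converts a small open cover of the exceptional times into the small total length that absolute
    continuity asks for. *)
Lemma sum_itv_le_measure {R : realType} (G : set R) (e : R) n (p q : 'I_n -> R) :
  measurable G -> (lebesgue_measure G < e%:E)%E ->
  (forall i, p i <= q i) -> (forall i, `]p i, q i[%classic `<=` G) ->
  trivIset setT (fun i => `]p i, q i[%classic) ->
  \sum_(i < n) (q i - p i) < e.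
Proof.
move=> mG Ge pq pqG tpq.
rewrite -lte_fin; apply: le_lt_trans Ge.
have mU : forall i : 'I_n, measurable (`]p i, q i[%classic : set R) by [].
have <- : lebesgue_measure (\big[setU/set0]_(i < n) `]p i, q i[%classic : set R) =
    (\sum_(i < n) (q i - p i))%:E.
  rewrite measure_bigsetU_ord// -sumEFin; apply: eq_bigr => i _.
  rewrite [LHS](lebesgue_measure_itv `]p i, q i[)/= lte_fin.
  have [//|qp] := ltP (p i) (q i).
  have -> : q i = p i by apply/le_anti; rewrite pq qp.
  by rewrite subrr.
apply: le_measure; rewrite ?inE//; first by apply: bigsetU_measurable.
by apply: (big_ind (fun B => B `<=` G)) => // B C BG CG x [/BG|/CG].
Qed.

(* Cousin-type argument: [a, b] is cut into finitely many intervals, each tagged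
   either by a point where f grows at rate at most k + e or lying in an open set of
   small measure covering the exceptional times; absolute continuity bounds the
   total contribution of the latter. *)
Lemma ac_increment_le {R : realType} (a b k : R) (f : R -> R) :
  0 <= k -> a <= b -> absolutely_continuous a b f ->
  {ae (@lebesgue_measure R), forall t, a < t < b ->
     exists2 d, is_derive t 1 f d & d <= k} ->
  f b - f a <= k * (b - a).
Proof.
move=> k0 ab acf aef.
(* The slack is spent twice: once as extra slope and once on the increments over the cover. Dividing
   it by b - a + 1 pays for both. *)
suff H : forall e, 0 < e -> f b - f a <= (k + e) * (b - a) + e.
  apply/ler_addgt0Pr => e e0.
  have c0 : 0 < b - a + 1 by lra.
  have := H (e / (b - a + 1)) (divr_gt0 e0 c0).
  rewrite mulrDl -addrA -{2}[e / _]mulr1 -mulrDr divfK//; exact: lt0r_neq0.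
move=> e e0.
have [d d0 dP] := acf e e0.
have : (@lebesgue_measure R).-negligible
  (~` [set t | a < t < b -> exists2 d, is_derive t 1 f d & d <= k]
     `|` ([set a] `|` [set b])).
  apply: negligibleU; first exact: aef.
  by apply: negligibleU; apply/negligibleP => //; exact: lebesgue_measure_set1.
move=> /negligible_open_cover/(_ d0) [G [oG NG Gd]].
(* Points s reached from a by a finite chain: increments over ordered intervals inside [G] are kept
   apart, the rest is charged to the slope k + e. The supremum of [A] will turn out to be b, and to
   lie in [A]. *)
pose A := [set s | a <= s <= b /\ exists (n : nat) (p q : nat -> R),
  [/\ forall i, (i < n)%N -> [/\ a <= p i, p i <= q i & q i <= s],
      forall i j, (i < j)%N -> (j < n)%N -> q i <= p j,
      forall i, (i < n)%N -> `]p i, q i[%classic `<=` G &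
      f s - f a <= (k + e) * (s - a) + \sum_(i < n) `|f (q i) - f (p i)|]].
have Aa : A a.
  split; first by rewrite lexx.
  exists 0%N, (fun=> 0), (fun=> 0); split => //.
  by rewrite big_ord0 !subrr mulr0 addr0.
have Abd : forall s, A s -> a <= s <= b by move=> s [].
have stepA : forall r s, A r -> r <= s -> s <= b ->
    f s - f r <= (k + e) * (s - r) \/ `]r, s[%classic `<=` G -> A s.
  move=> r s [/andP[ar rb] [n [p [q [h1 h2 h3 h4]]]]] rs sb hrs.
  split; first by rewrite (le_trans ar rs).
  case: hrs => [hrs|rsG].
    exists n, p, q; split => //.
      by move=> i /h1[-> -> qr]; split => //; exact: le_trans rs.
    by lra.
  exists n.+1, (fun i => if (i < n)%N then p i else r),
    (fun i => if (i < n)%N then q i else s); split.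
  - move=> i _; case: ifPn => // /h1[-> -> qr]; split => //; exact: le_trans rs.
  - move=> i j ij; rewrite ltnS leq_eqVlt => /predU1P[jn|jn].
      by move: ij; rewrite jn ltnn => ij; rewrite ij; case: (h1 _ ij).
    by rewrite jn (ltn_trans ij jn); exact: h2.
  - by move=> i _; case: ifPn => // /h3.
  - rewrite big_ord_recr/= ltnn.
    under eq_bigr do rewrite ltn_ord.
    have : 0 <= (k + e) * (s - r) by rewrite mulr_ge0 ?subr_ge0// addr_ge0// ltW.
    have := ler_norm (f s - f r).
    lra.
have supA : has_sup A by split; [exists a|exists b => s /Abd/andP[]].
set c := sup A.
have ac : a <= c by exact: sup_upper_bound.
have cb : c <= b by apply: ge_sup; [exists a|move=> s /Abd/andP[]].
(* Around c, either [G] contains a whole neighbourhood, or f has a derivative at c; in the latter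
   case the two one-sided estimates at c add up for r <= c <= s. The end points were put into the
   null set, so a point c outside [G] is interior. *)
have [d' d'0 d'P] : exists2 d', 0 < d' & forall r s, c - d' < r -> r <= c -> c <= s ->
    s < c + d' -> f s - f r <= (k + e) * (s - r) \/ `]r, s[%classic `<=` G.
  have [Gc|Gc] := pselect (G c).
    move: (oG); rewrite openE => /(_ _ Gc)/nbhs_ballP[r/= r0 rG].
    exists r => // x y cx xc cy yc; right => z/=; rewrite in_itv/= => /andP[xz zy].
    by apply: rG; rewrite /ball/= ltr_distlC; lra.
  have [d1 fd1 d1k] : exists2 d, is_derive c 1 f d & d <= k.
    have [//|NNc] := pselect (exists2 d, is_derive c 1 f d & d <= k).
    exfalso; apply: Gc; apply: NG.
    have [->|ca] := eqVneq c a; first by right; left.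
    have [->|cb'] := eqVneq c b; first by right; right.
    by left => /= /(_ _)/NNc; apply; rewrite !lt_neqAle ac cb eq_sym ca cb'.
  have /nbhs_ballP[r/= r0 rP] := is_derive_near _ _ _ fd1 e e0.
  exists r => // x y cx xc cy yc; left.
  have := rP x; rewrite /ball/= ltr_distlC => /(_ _).
  have := rP y; rewrite /ball/= ltr_distlC => /(_ _).
  rewrite (ger0_norm (_ : 0 <= y - c)) ?subr_ge0//.
  rewrite (ler0_norm (_ : x - c <= 0)) ?subr_le0//.
  rewrite !ler_norml => /(_ _)/andP; case; first lra.
  move=> _ h1 /(_ _)/andP; case; first lra.
  move=> h2 _.
  have : d1 * (y - x) <= k * (y - x) by rewrite ler_wpM2r// subr_ge0 (le_trans xc).
  lra.
have [r Ar cr] := sup_adherent d'0 supA.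
have rc : r <= c by exact: sup_upper_bound.
(* A chain ending just before c steps over c to s; as s cannot exceed the supremum c, it must be
   b. *)
pose s := Num.min b (c + d' / 2).
have cs : c <= s by rewrite le_min cb; lra.
have As : A s.
  apply: (stepA r) => //; first exact: le_trans rc cs.
    by rewrite ge_min lexx.
  by apply: d'P => //; rewrite gt_min; apply/orP; right; lra.
have sc : s <= c by exact: sup_upper_bound.
have sb : s = b.
  by move: sc; rewrite /s; case: (leP b) => //; lra.
move: As; rewrite sb => -[_ [n [p [q [h1 h2 h3 h4]]]]].
apply: le_trans h4 _; rewrite lerD2l; apply/ltW.
have tI : trivIset setT (fun i : 'I_n => `]p i, q i[%classic).
  move=> i j _ _ [z [/=]]; rewrite !in_itv/= => /andP[iz zi] /andP[jz zj].
  apply/val_inj; case: (ltngtP i j) => // ij.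
    by have := lt_trans (lt_le_trans zi (h2 _ _ ij (ltn_ord _))) jz; rewrite ltxx.
  by have := lt_trans (lt_le_trans zj (h2 _ _ ij (ltn_ord _))) iz; rewrite ltxx.
apply: (dP n (fun i => p i) (fun i => q i)) => //; first by move=> i; apply: h1.
apply: (sum_itv_le_measure G) => //.
- exact: open_measurable.
- by move=> i; have [] := h1 i (ltn_ord i).
- by move=> i; apply: h3.
Qed.

(** * Derivatives, one-sided at the initial time *)

Lemma near_is_derive {R : realType} (f : R -> R) (t d : R) :
  (forall e, 0 < e ->
    \forall s \near t, `|f s - f t - d * (s - t)| <= e * `|s - t|) ->
  is_derive t 1 f d.
Proof.
move=> H.
have cv : (h^-1 *: ((f \o shift t) (h *: (1 : R)) - f t)) @[h --> 0^'] --> d.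
  apply/cvgrPdist_le => e /= /H/nbhs_ballP[r /= r0 rP].
  apply/nbhs_ballP; exists r => //= h; rewrite /ball/= sub0r normrN => hr h0.
  have := rP (h + t); rewrite /ball/= opprD addrCA subrr addr0 normrN => /(_ hr).
  rewrite addrK /GRing.scale/= mulr1 => hP.
  have nh0 : 0 < `|h| by rewrite normr_gt0.
  rewrite -(ler_pM2r nh0).
  rewrite -normrM mulrBl mulrAC mulVf// mul1r distrC.
  exact: hP.
by apply: DeriveDef; [apply/cvgP; exact: cv|exact: cvg_lim cv].
Qed.

Lemma has_derivative_within_near {R : realType} (D : set R) (f : R -> R) (t d : R) :
  has_derivative_within D f t d -> forall e, 0 < e ->
  \forall s \near t, D s -> `|f s - f t - d * (s - t)| <= e * `|s - t|.
Proof.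
move=> /cvgrPdist_le H e /H; rewrite near_withinE.
move=> /nbhs_ballP[r /= r0 rP]; apply/nbhs_ballP; exists r => //= s ts Ds.
have [->|st] := eqVneq s t; first by rewrite !subrr mulr0 subr0 !normr0 mulr0.
have st0 : s - t != 0 by rewrite subr_eq0.
have {}H := rP s ts st Ds.
have -> : f s - f t - d * (s - t) = - ((d - (f s - f t) / (s - t)) * (s - t)).
  by field.
by rewrite normrN normrM ler_wpM2r.
Qed.

Lemma has_derivative_within_is_derive {R : realType} (t0 t d : R) (f : R -> R) :
  t0 < t -> has_derivative_within `[t0, +oo[ f t d -> is_derive t 1 f d.
Proof.
move=> t0t /has_derivative_within_near H; apply: near_is_derive => e /H {}H.
near=> s; apply: (near H s) => //=.
rewrite in_itv/= andbT ltW//; near: s; exact: lt_nbhsr.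
Unshelve. all: by end_near. Qed.

Lemma has_derivative_within_continuous {R : realType} (D : set R) (f : R -> R)
    (t d : R) :
  has_derivative_within D f t d -> f s @[s --> within D (nbhs t)] --> f t.
Proof.
move=> /has_derivative_within_near/(_ _ ltr01) H.
apply/cvgrPdist_le => e e0; rewrite near_withinE.
have r0 : 0 < e / (`|d| + 1) by rewrite divr_gt0// ltr_wpDl.
near=> s => Ds.
have H1 : `|f s - f t - d * (s - t)| <= 1 * `|s - t| by apply: (near H s).
have H2 : `|s - t| <= e / (`|d| + 1).
  rewrite distrC ltW//; near: s; apply/nbhs_ballP; exists (e / (`|d| + 1)) => //.
rewrite distrC -(subrK (d * (s - t)) (f s - f t)).
apply: le_trans (ler_normD _ _) _; rewrite normrM.
rewrite -[leRHS](divfK (_ : `|d| + 1 != 0)) ?lt0r_neq0 ?ltr_wpDl//.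
apply: le_trans (lerD H1 (lexx _)) _.
by rewrite -mulrDl addrC mulrC; apply: ler_wpM2r => //; rewrite addr_ge0.
Unshelve. all: by end_near. Qed.

(** The mean value theorem asks for two-sided derivatives only inside the interval and for mere
    continuity at its ends, so a = t0 is covered. *)
Lemma has_derivative_within_lipschitz {R : realType} (t0 T k : R) (f df : R -> R) :
  (forall t, t0 <= t -> has_derivative_within `[t0, +oo[ f t (df t)) ->
  (forall t, t0 <= t <= T -> `|df t| <= k) ->
  forall a b, t0 <= a -> a <= b -> b <= T -> `|f b - f a| <= k * (b - a).
Proof.
move=> fdf dfk a b ta ab bT.
have [||c cab ->] := @MVT_segment R f df a b ab.
- move=> x; rewrite in_itv/= => /andP[ax xb].
  apply: (has_derivative_within_is_derive t0); first exact: le_lt_trans ax.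
  by apply: fdf; rewrite (le_trans ta)// ltW.
- apply/subspace_continuousP => x /=; rewrite in_itv/= => /andP[ax xb].
  have sub : `[a, b] `<=` `[t0, +oo[%classic.
    by move=> y /=; rewrite !in_itv/= andbT => /andP[/(le_trans ta)].
  apply: cvg_trans (has_derivative_within_continuous _ _ _ _ (fdf x (le_trans ta ax))).
  by apply: cvg_app; exact: within_subset.
rewrite normrM (ger0_norm (_ : 0 <= b - a)) ?subr_ge0// ler_wpM2r ?subr_ge0//.
move: cab; rewrite in_itv/= => /andP[ac cb].
by apply: dfk; rewrite (le_trans ta ac) (le_trans cb).
Qed.

(** Whatever the signs of s and y, the first-order remainder is at most (s - y)^2; the kink of the
    positive part disappears on squaring. *)
Lemma is_derive_sqr_pos {R : realType} (y : R) :
  is_derive y 1 (fun z : R => Num.max z 0 ^+ 2) (2 * Num.max y 0).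
Proof.
apply: near_is_derive => e e0.
apply/nbhs_ballP; exists e => //= s; rewrite /ball/= distrC => sy.
apply: (@le_trans _ _ (`|s - y| * `|s - y|)); last by rewrite ler_wpM2r// ltW.
rewrite -normrM -expr2 (ger0_norm (sqr_ge0 _)) ler_norml.
have [s0|s0] := ltP s 0; have [y0|y0] := ltP y 0; apply/andP; split.
all: by rewrite ?(expr2 0) ?mulr0 ?mul0r; have := sqr_ge0 (s - y); nra.
Qed.

(** Common source of the closure properties below: sums, scalar multiples and squared positive
    parts. *)
Lemma ac_dominated {R : realType} (a b C : R) (f g h : R -> R) :
  absolutely_continuous a b g -> absolutely_continuous a b h ->
  (forall x y, a <= x <= b -> a <= y <= b ->
    `|f y - f x| <= C * (`|g y - g x| + `|h y - h x|)) ->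
  absolutely_continuous a b f.
Proof.
move=> acg ach fgh e e0.
have C0 : 0 < `|C| + 1 by rewrite ltr_wpDl.
have e'0 : 0 < e / (`|C| + 1) / 2 by rewrite !divr_gt0.
have [d1 d10 H1] := acg _ e'0.
have [d2 d20 H2] := ach _ e'0.
exists (Num.min d1 d2) => [|n p q pq tpq]; first by rewrite lt_min d10.
rewrite lt_min => /andP[/H1-/(_ pq tpq) {}H1 /H2-/(_ pq tpq) {}H2].
apply: (@le_lt_trans _ _ ((`|C| + 1) * (\sum_(i < n) `|g (q i) - g (p i)| +
    \sum_(i < n) `|h (q i) - h (p i)|))).
  rewrite -big_split/= mulr_sumr; apply: ler_sum => i _.
  have [api piqi qib] := pq i.
  apply: le_trans (fgh (p i) (q i) _ _) _.
  - by rewrite api (le_trans piqi).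
  - by rewrite qib (le_trans api).
  - by apply: ler_wpM2r; [rewrite addr_ge0|rewrite (le_trans (ler_norm C))// lerDl].
rewrite mulrC -ltr_pdivlMr//; lra.
Qed.

Lemma ac_lipschitz {R : realType} (a b k : R) (f : R -> R) :
  (forall x y, a <= x -> x <= y -> y <= b -> `|f y - f x| <= k * (y - x)) ->
  absolutely_continuous a b f.
Proof.
move=> fk e e0.
have k0 : 0 < `|k| + 1 by rewrite ltr_wpDl.
exists (e / (`|k| + 1)) => [|n p q pq tpq]; first by rewrite divr_gt0.
rewrite ltr_pdivlMr// => /le_lt_trans; apply.
rewrite mulr_suml; apply: ler_sum => i _.
have [api piqi qib] := pq i.
apply: le_trans (fk (p i) (q i) _ _ _) _ => //.
rewrite mulrC; apply: ler_wpM2l; first by rewrite subr_ge0.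
by rewrite (le_trans (ler_norm k))// lerDl.
Qed.

Lemma acD {R : realType} (a b : R) (f g : R -> R) :
  absolutely_continuous a b f -> absolutely_continuous a b g ->
  absolutely_continuous a b (fun t => f t + g t).
Proof.
move=> acf acg; apply: (ac_dominated a b 1 _ f g) => // x y _ _.
by rewrite mul1r opprD addrACA ler_normD.
Qed.

Lemma acZ {R : realType} (a b c : R) (f : R -> R) :
  absolutely_continuous a b f -> absolutely_continuous a b (fun t => c * f t).
Proof.
move=> acf; apply: (ac_dominated a b `|c| _ f f) => // x y _ _.
by rewrite -mulrBr normrM ler_wpM2l// lerDl.
Qed.

Lemma ac_uniform {R : realType} (a b : R) (f : R -> R) :
  absolutely_continuous a b f -> forall e, 0 < e -> exists2 d, 0 < d &
  forall x y, a <= x <= b -> a <= y <= b -> `|x - y| < d -> `|f x - f y| < e.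
Proof.
move=> acf e /acf[d d0 dP]; exists d => //.
have H x y : a <= x -> x <= y -> y <= b -> y - x < d -> `|f y - f x| < e.
  move=> ax xy yb xyd.
  have := dP 1%N (fun=> x) (fun=> y).
  rewrite !big_ord1; apply => //.
  by move=> i j _ _ _; rewrite (ord1 i) (ord1 j).
move=> x y /andP[ax xb] /andP[ay yb]; have [xy|yx] := leP x y.
  by rewrite distrC ger0_norm ?subr_ge0// => xyd; rewrite distrC H.
by rewrite gtr0_norm ?subr_gt0// => xyd; rewrite H// ltW.
Qed.

Lemma ac_continuous {R : realType} (a b : R) (f : R -> R) :
  absolutely_continuous a b f -> {within `[a, b], continuous f}.
Proof.
move=> acf; apply/subspace_continuousP => x /= xab.
apply/cvgrPdist_lt => e /(ac_uniform _ _ _ acf)[d d0 dP].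
rewrite near_withinE; apply/nbhs_ballP; exists d => //= y xy yab.
by move: xab yab; rewrite !in_itv => xab yab; apply: dP.
Qed.

Lemma ac_bounded {R : realType} (a b : R) (f : R -> R) :
  absolutely_continuous a b f -> exists B : R, forall x, a <= x <= b -> `|f x| <= B.
Proof.
move=> /ac_continuous cf.
have /compact_bounded[M [_ MP]] := continuous_compact cf (@segment_compact R a b).
exists (M + 1) => x xab; apply: (MP (M + 1)); first by rewrite ltrDl.
by exists x => //=; rewrite in_itv.
Qed.

(** The squared positive part is Lipschitz only on bounded sets: with constant 2 B on [-B, B], where
    B bounds f. *)
Lemma ac_sqr_pos {R : realType} (a b : R) (f : R -> R) :
  absolutely_continuous a b f ->
  absolutely_continuous a b (fun t => Num.max (f t) 0 ^+ 2).
Proof.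
move=> acf; have [B HB] := ac_bounded _ _ _ acf.
apply: (ac_dominated a b (2 * B) _ f f) => //= x y xab yab.
have [h1 h2] : - B <= f x /\ f x <= B by apply/andP; rewrite -ler_norml HB.
have [h3 h4] : - B <= f y /\ f y <= B by apply/andP; rewrite -ler_norml HB.
move: (f x) (f y) h1 h2 h3 h4 => u v h1 h2 h3 h4.
apply: (@le_trans _ _ (2 * B * `|v - u|)); last first.
  by rewrite ler_wpM2l ?lerDl//; lra.
rewrite ler_norml; have [u0|u0] := ltP u 0; have [v0|v0] := ltP v 0.
all: rewrite ?(expr2 0) ?mulr0.
all: have [uv|uv] := ler0P (v - u); apply/andP; split; nra.
Qed.

Lemma ac_subitv {R : realType} (a b c d : R) (f : R -> R) :
  a <= c -> d <= b -> absolutely_continuous a b f -> absolutely_continuous c d f.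
Proof.
move=> ac db acf e /acf[r r0 H]; exists r => // n p q pq; apply: H => i.
have [cp pqi qd] := pq i.
by split => //; [exact: le_trans cp|exact: le_trans db].
Qed.

Lemma ac_gronwall {R : realType} (a b k : R) (f : R -> R) :
  0 <= k -> k * (b - a) < 1 -> a <= b -> absolutely_continuous a b f ->
  (forall t, 0 <= f t) -> f a = 0 ->
  {ae (@lebesgue_measure R), forall t, a < t < b ->
     exists2 d, is_derive t 1 f d & d <= k * f t} ->
  forall t, a <= t <= b -> f t = 0.
Proof.
move=> k0 kab ab acf f0 fa aef.
have [c] := EVT_max ab (ac_continuous _ _ _ acf).
rewrite in_itv/= => /andP[ac cb] fc.
have fm t : a <= t <= b -> f t <= f c by move=> tab; apply: fc; rewrite in_itv.
suff fc0 : f c = 0.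
  by move=> t /fm; rewrite fc0 => ft; apply/le_anti; rewrite ft f0.
have : f c - f a <= k * f c * (c - a).
  apply: ac_increment_le => //; first by rewrite mulr_ge0.
    exact: ac_subitv acf.
  apply: negligibleS aef; apply: subsetC => t H /andP[at_ tc].
  have tb : t < b by exact: lt_le_trans cb.
  have [|d fd dk] := H; first by rewrite at_ tb.
  exists d => //; apply: le_trans dk _; rewrite ler_wpM2l// fm//.
  by rewrite !ltW.
rewrite fa subr0 => h.
have h2 : k * (c - a) <= k * (b - a) by rewrite ler_wpM2l// lerD2r.
have := f0 c; nra.
Qed.

(** * Geometry of the safe set *)

(** For v > 0, [H_ub] <= 0 implies [h_ub] <= 0 and [h_lb] <= 0 implies [H_lb] <= 0; for v <= 0 the
    roles are exchanged. One constraint per side thus survives, and the positive part selects it. *)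
Lemma safe_setP {R : realType} (amax : R) (lub llb dl : R -> R) (t : R) (x : R * R) :
  0 < amax ->
  safe_set amax lub llb dl t x <->
  x.1 - lub t + Num.max (x.2 - dl t) 0 ^+ 2 / (2 * amax) <= 0 /\
  - (x.1 - llb t) + Num.max (- (x.2 - dl t)) 0 ^+ 2 / (2 * amax) <= 0.
Proof.
move=> a0; rewrite /safe_set/= /H_ub /h_ub /H_lb /h_lb.
set v := x.2 - dl t.
have V : 0 <= v ^+ 2 / (2 * amax) by rewrite divr_ge0 ?sqr_ge0// mulr_ge0// ltW.
have [v0|v0] := ltP 0 v.
- have nv : - v <= 0 by rewrite oppr_le0 ltW.
  rewrite (max_r nv) (gtr0_norm v0) -expr2.
  by rewrite expr0n/= mul0r; split => [[]|[]]; first split; try split; lra.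
- have nv : 0 <= - v by rewrite oppr_ge0.
  rewrite (max_l nv) (ler0_norm v0) sqrrN mulNr -expr2.
  by rewrite expr0n/= mulNr mul0r; split => [[]|[]]; first split; try split; lra.
Qed.

(* The nearest boundary point with the same [v] works unless [v] exceeds its
   largest admissible value sqrt (2 a g); then the corner of the set is used. *)
Lemma near_braking_curve {R : realType} (a g : R) : 0 < a -> 0 < g ->
  exists2 C : R, 0 <= C & forall p v : R,
  0 < v -> 0 < p - g + v ^+ 2 / (2 * a) ->
  let s := C * (p - g + v ^+ 2 / (2 * a) + Num.max (- p) 0) in
  exists p' v' : R, [/\ 0 < v', 0 <= p', p' - g + v' ^+ 2 / (2 * a) = 0,
    `|p - p'| <= s & `|v - v'| <= s].
Proof.
move=> a0 g0; set m := Num.sqrt (2 * a * g).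
have m0 : 0 < m by rewrite sqrtr_gt0 !mulr_gt0.
have m2 : m ^+ 2 = 2 * a * g by rewrite sqr_sqrtr// ltW// !mulr_gt0.
have C0 : 0 <= 2 * a / m by apply/ltW; rewrite divr_gt0// mulr_gt0.
(* The 1 pays for the displacement of p. The term 2 a / m pays for that of v in the corner case,
   where (v - m) m <= v^2 - m^2. *)
exists (1 + 2 * a / m) => [|p v v0 M0 s]; first by lra.
move: @s M0; set M := p - g + _ => s M0.
have N0 : 0 <= Num.max (- p) 0 by rewrite le_max lexx orbT.
have Np : - p <= Num.max (- p) 0 by rewrite le_max lexx.
have Ms : M <= s.
  rewrite /s; have : 0 <= 2 * a / m * (M + Num.max (- p) 0).
    by rewrite mulr_ge0// addr_ge0// ltW.
  lra.
have vE : v ^+ 2 = (M - p + g) * (2 * a) by rewrite /M; field; exact: lt0r_neq0.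
have [vm|mv] := leP v m.
  exists (g - v ^+ 2 / (2 * a)), v; split => //.
  - rewrite subr_ge0 ler_pdivrMr ?mulr_gt0//.
    have -> : g * (2 * a) = m ^+ 2 by rewrite m2; ring.
    by rewrite ler_sqr ?nnegrE // ltW.
  - by ring.
  - by rewrite opprB addrA addrAC ger0_norm// /M ltW.
  - by rewrite subrr normr0 (le_trans _ Ms)// ltW.
exists 0, m; split => //.
- by rewrite m2; field; exact: lt0r_neq0.
- rewrite subr0 ler_norml; apply/andP; split.
    rewrite lerNl (le_trans Np)// /s.
    have : 0 <= 2 * a / m * (M + Num.max (- p) 0) by rewrite mulr_ge0// addr_ge0// ltW.
    have := M0; lra.
  apply: le_trans Ms.
  have : m ^+ 2 < v ^+ 2 by rewrite ltr_sqr ?nnegrE // ltW.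
  rewrite m2 vE; nra.
- rewrite gtr0_norm ?subr_gt0//.
  apply: (@le_trans _ _ (2 * a / m * (M + Num.max (- p) 0))); last first.
    by rewrite /s; lra.
  rewrite mulrAC ler_pdivlMr//.
  have : v ^+ 2 - m ^+ 2 <= 2 * a * (M + Num.max (- p) 0).
    rewrite m2 vE; nra.
  nra.
Qed.

(** On this curve the factor of alpha in [Phi_ub] vanishes, so the bound no longer depends on
    alpha. *)
Lemma control_le_upper_boundary {R : realType}
    (amax wmax ulb uub alpha_ub alpha_lb : R) (lub llb dl ddl : R -> R)
    (t : R) (x : R * R) (u : R) :
  dl t < x.2 -> x.1 - lub t + (x.2 - dl t) ^+ 2 / (2 * amax) = 0 ->
  U_c amax wmax ulb uub alpha_ub alpha_lb lub llb dl ddl t x u ->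
  u <= - amax - wmax + ddl t.
Proof.
move=> v0 H0 [_ H _].
have /andP[_] := H (negbT (gt_eqF v0)).
rewrite /Phi_ub; have v1 : 0 < x.2 - dl t by rewrite subr_gt0.
rewrite (gtr0_norm v1) (gtr0_sg v1).
have -> : - x.1 + lub t - (x.2 - dl t) * (x.2 - dl t) / (2 * amax) = 0.
  by move: H0; rewrite expr2; lra.
by rewrite mulr0 mul1r sub0r.
Qed.

Lemma control_ge_lower_boundary {R : realType}
    (amax wmax ulb uub alpha_ub alpha_lb : R) (lub llb dl ddl : R -> R)
    (t : R) (x : R * R) (u : R) :
  x.2 < dl t -> - (x.1 - llb t) + (x.2 - dl t) ^+ 2 / (2 * amax) = 0 ->
  U_c amax wmax ulb uub alpha_ub alpha_lb lub llb dl ddl t x u ->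
  amax + wmax + ddl t <= u.
Proof.
move=> v0 H0 [_ H _].
have /andP[+ _] := H (negbT (lt_eqF v0)).
rewrite /Phi_lb; have v1 : x.2 - dl t < 0 by rewrite subr_lt0.
rewrite (ltr0_norm v1) (ltr0_sg v1).
have -> : x.1 - llb t + - (x.2 - dl t) * (x.2 - dl t) / (2 * amax) = 0.
  by move: H0; rewrite expr2 !mulNr; lra.
by rewrite mulr0 mulN1r opprK add0r.
Qed.

(** Two intervals must meet. On the safe set the alpha terms have a favourable sign, so [amax_bound]
    of the theorem, assumed here as well, gives [Phi_lb] <= [uub] and [ulb] <= [Phi_ub]; the bound
    on alpha gives [Phi_lb] <= [Phi_ub]. *)
Lemma control_set_nonempty {R : realType}
    (wmax ulb uub ddlmax amax alpha : R) (lub llb dl ddl : R -> R) (t : R) (x : R * R) :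
  0 <= wmax -> ulb <= uub -> `|ddl t| <= ddlmax -> 0 < amax ->
  Num.max (ulb + wmax + ddlmax) (- uub + wmax + ddlmax) <= - amax ->
  0 < lub t - llb t -> 0 < alpha ->
  2 * wmax * Num.sqrt (2 / ((lub t - llb t) * amax)) <= alpha ->
  safe_set amax lub llb dl t x ->
  U_c amax wmax ulb uub alpha alpha lub llb dl ddl t x !=set0.
Proof.
move=> w0 ulu; rewrite ler_norml => /andP[d1 d2] a0.
rewrite ge_max => /andP[b1 b2] g0 al0 al xS.
have [Hub _ Hlb _] := xS.
have [x1 x2] := (safe_setP _ _ _ _ _ _ a0).1 xS.
have [vE|v0] := eqVneq x.2 (dl t).
  exists ulb; split; rewrite ?lexx ?vE ?eqxx//= => _ w _.
  rewrite /Hdot_lb /Hdot_ub vE subrr normr0 !mul0r addNr !addr0.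
  by rewrite !mulr_ge0 ?oppr_ge0// ltW.
set v := x.2 - dl t in Hub Hlb x1 x2.
have nv : v != 0 by rewrite subr_eq0.
have av : 0 < `|v| by rewrite normr_gt0.
set P := Phi_lb amax wmax alpha llb dl ddl t x.
set Q := Phi_ub amax wmax alpha lub dl ddl t x.
have k0 : 0 <= amax / `|v| * alpha by rewrite mulr_ge0 ?divr_ge0// ltW.
have Ple : P <= - (Num.sg v * amax) + wmax + ddl t.
  rewrite /P /Phi_lb -/v !lerD2r mulNr mulNr.
  rewrite gerDr oppr_le0 mulr_ge0//.
  by move: Hlb; rewrite /H_lb -/v; lra.
have Qge : - (Num.sg v * amax) - wmax + ddl t <= Q.
  rewrite /Q /Phi_ub -/v !lerD2r lerDr mulr_ge0//.
  by move: Hub; rewrite /H_ub -/v; lra.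
have sgv : - amax <= Num.sg v * amax <= amax.
  by case: sgrP; rewrite ?mul0r ?mul1r ?mulN1r; lra.
have PQ : P <= Q.
  rewrite -subr_ge0.
  have -> : Q - P = amax / `|v| * alpha * (lub t - llb t) - 2 * wmax.
    by rewrite /Q /P /Phi_ub /Phi_lb -/v; ring.
  rewrite subr_ge0.
  (* Adding the two inequalities of [safe_setP] eliminates x1; one of the positive parts is |v| and
     the other is 0. *)
  have vm : `|v| ^+ 2 <= 2 * amax * (lub t - llb t).
    rewrite -normrX ger0_norm ?sqr_ge0//.
    have a20 : 0 < 2 * amax by lra.
    rewrite mulrC -ler_pdivrMr//.
    have Z1 : 0 <= Num.max v 0 ^+ 2 / (2 * amax) by rewrite divr_ge0 ?sqr_ge0// ltW.
    have Z2 : 0 <= Num.max (- v) 0 ^+ 2 / (2 * amax) by rewrite divr_ge0 ?sqr_ge0// ltW.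
    move: x1 x2 Z1 Z2; have [v1|v1] := ltP 0 v; first lra.
    have nv0 : 0 <= - v by rewrite oppr_ge0.
    rewrite (max_l nv0) sqrrN; lra.
  set r := Num.sqrt _ in al.
  have ga : 0 < (lub t - llb t) * amax by rewrite mulr_gt0.
  have r0 : 0 < r by rewrite sqrtr_gt0 divr_gt0.
  have r2 : r ^+ 2 * ((lub t - llb t) * amax) = 2.
    by rewrite sqr_sqrtr ?divfK ?lt0r_neq0// divr_ge0// ltW.
  (* The right-hand side is sqrt (2 a g) with g the gap, rewritten through r so that the lower bound
     2 wmax r on alpha applies directly. *)
  have vr : `|v| <= r * ((lub t - llb t) * amax).
    have rga : 0 <= r * ((lub t - llb t) * amax) by rewrite ltW// mulr_gt0.
    rewrite -ler_sqr ?nnegrE//.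
    rewrite exprMn [X in _ * X]expr2 mulrA r2; apply: le_trans vm _.
    by rewrite -mulrA [amax * _]mulrC.
  rewrite [leRHS](_ : _ = alpha * ((lub t - llb t) * amax) / `|v|); last first.
    by field; exact: lt0r_neq0.
  rewrite ler_pdivlMr//.
  apply: (@le_trans _ _ (2 * wmax * (r * ((lub t - llb t) * amax)))).
    by rewrite ler_wpM2l// mulr_ge0.
  by rewrite [leLHS]mulrA ler_wpM2r// ltW.
exists (Num.max ulb P); split.
- by rewrite le_max lexx ge_max ulu/=; lra.
- by move=> _; rewrite -/P -/Q le_max lexx orbT ge_max PQ andbT/=; lra.
- by move=> vE; move: v0; rewrite vE eqxx.
Qed.

(** The term in v is the distance covered while braking from v > 0 to rest at deceleration a. The
    upper constraint is q = p - g; the lower one is its mirror image, with - p and - v. *)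
Definition excess {R : realType} (a q v : R) : R :=
  q + Num.max v 0 ^+ 2 / (2 * a).

(* Unlike the distance to the safe set, this is C^1 in the state. *)
Definition violation {R : realType} (a g p v : R) : R :=
  Num.max (excess a (p - g) v) 0 ^+ 2 + Num.max (excess a (- p) (- v)) 0 ^+ 2.

Lemma violation_ge0 {R : realType} (a g p v : R) : 0 <= violation a g p v.
Proof. by rewrite addr_ge0// sqr_ge0. Qed.

Lemma violation_eq0 {R : realType} (a g p v : R) :
  violation a g p v = 0 <-> excess a (p - g) v <= 0 /\ excess a (- p) (- v) <= 0.
Proof.
split=> [/eqP|[h1 h2]].
  by rewrite paddr_eq0 ?sqr_ge0// !sqrf_eq0 => /andP[/eqP/max_idPr h1 /eqP/max_idPr h2].
by rewrite /violation !max_r// expr0n addr0.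
Qed.

Lemma ac_excess {R : realType} (a b c : R) (q v : R -> R) :
  absolutely_continuous b c q -> absolutely_continuous b c v ->
  absolutely_continuous b c (fun t => excess a (q t) (v t)).
Proof.
move=> acq acv; rewrite /excess; apply: acD => //.
rewrite [X in absolutely_continuous _ _ X](_ : _ =
    fun t => (2 * a)^-1 * Num.max (v t) 0 ^+ 2); last by apply/funext => t; rewrite mulrC.
exact/acZ/ac_sqr_pos.
Qed.

Lemma ac_violation {R : realType} (a g b c : R) (p v : R -> R) :
  absolutely_continuous b c p -> absolutely_continuous b c v ->
  absolutely_continuous b c (fun t => violation a g (p t) (v t)).
Proof.
move=> acp acv; rewrite /violation; apply: acD.
  apply/ac_sqr_pos/ac_excess => //; apply: acD => //.
  by apply: (ac_lipschitz b c 0) => x y _ _ _; rewrite subrr normr0 mul0r.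
have acN f : absolutely_continuous b c f -> absolutely_continuous b c (fun t => - f t).
  move=> /(acZ b c (-1)); rewrite [X in _ _ X -> _](_ : _ = fun t => - f t)//.
  by apply/funext => t; rewrite mulN1r.
by apply/ac_sqr_pos/ac_excess; exact: acN.
Qed.

(** * Growth of the violation along trajectories *)

Lemma is_derive_excess {R : realType} (a t dq dv : R) (q v : R -> R) :
  is_derive t 1 q dq -> is_derive t 1 v dv ->
  is_derive t 1 (fun s => excess a (q s) (v s)) (dq + Num.max (v t) 0 / a * dv).
Proof.
move=> hq hv.
have h1 := is_derive1_comp (is_derive_sqr_pos (v t)) hv.
have h2 := is_deriveD hq (is_deriveZ (2 * a)^-1 h1).
rewrite [X in is_derive _ _ X](_ : _ =
    q + (2 * a)^-1 \*: ((fun z : R => Num.max z 0 ^+ 2) \o v)); last first.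
  by apply/funext => s; rewrite /excess mulrC.
apply: is_derive_eq h2 _.
by rewrite /GRing.scale/= invfM; move: a^-1 => b; field.
Qed.

Lemma is_derive_violation {R : realType} (a g t dp dv : R) (p v : R -> R) :
  is_derive t 1 p dp -> is_derive t 1 v dv ->
  is_derive t 1 (fun s => violation a g (p s) (v s))
    (2 * Num.max (excess a (p t - g) (v t)) 0 * (dp + Num.max (v t) 0 / a * dv) +
     2 * Num.max (excess a (- p t) (- v t)) 0 * (- dp + Num.max (- v t) 0 / a * - dv)).
Proof.
move=> hp hv.
have hq : is_derive t 1 (fun s => p s - g) dp.
  by apply: is_derive_eq; rewrite subr0.
have hp' : is_derive t 1 (fun s => - p s) (- dp) by exact: is_deriveN.
have hv' : is_derive t 1 (fun s => - v s) (- dv) by exact: is_deriveN.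
have h1 := is_derive1_comp (is_derive_sqr_pos _) (is_derive_excess a _ _ _ _ _ hq hv).
have h2 := is_derive1_comp (is_derive_sqr_pos _) (is_derive_excess a _ _ _ _ _ hp' hv').
exact: is_deriveD h1 h2.
Qed.

(** Here c stands for the acceleration v' and s bounds the distance to a boundary point. If v <= 0
    the rate is v itself; if v > 0, the - a in the bound on c cancels v and leaves (v / a) L s.
    [near_braking_curve] supplies the boundary point. *)
Lemma violation_rate_upper {R : realType} (a g : R) : 0 < a -> 0 < g ->
  exists2 C : R, 0 <= C & forall p v c L : R, 0 <= L ->
  let s := C * (Num.max (excess a (p - g) v) 0 + Num.max (excess a (- p) (- v)) 0) in
  (forall p' v', 0 < v' -> 0 <= p' -> p' - g + v' ^+ 2 / (2 * a) = 0 ->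
     `|p - p'| <= s -> `|v - v'| <= s -> c <= - a + L * s) ->
  Num.max (excess a (p - g) v) 0 * (v + Num.max v 0 / a * c) <=
  Num.max (excess a (p - g) v) 0 * (`|v| / a * (L * s)).
Proof.
move=> a0 g0; have [C C0 HC] := near_braking_curve a g a0 g0.
exists C => // p v c L L0 s Hc.
have m0 (y : R) : 0 <= Num.max y 0 by rewrite le_max lexx orbT.
have s0 : 0 <= s by rewrite mulr_ge0// addr_ge0.
have k0 : 0 <= `|v| / a by rewrite divr_ge0// ltW.
have [M0|M0] := leP (excess a (p - g) v) 0.
  by rewrite !mul0r.
apply: ler_wpM2l; first exact: ltW.
have [v0|v0] := leP v 0.
  rewrite !mul0r addr0 (le_trans v0)//.
  by rewrite mulr_ge0// mulr_ge0.
rewrite (gtr0_norm v0).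
suff cs : c <= - a + L * s.
  apply: (@le_trans _ _ (v + v / a * (- a + L * s))).
    by rewrite lerD2l ler_wpM2l// divr_ge0// ltW.
  rewrite mulrDr mulrN divfK ?lt0r_neq0//; lra.
have ME : excess a (p - g) v = p - g + v ^+ 2 / (2 * a).
  by rewrite /excess (max_idPl (ltW v0)).
have NE : excess a (- p) (- v) = - p.
  have nv : - v <= 0 by rewrite oppr_le0 ltW.
  by rewrite /excess (max_idPr nv) expr0n mul0r addr0.
have sE : s = C * (p - g + v ^+ 2 / (2 * a) + Num.max (- p) 0).
  by rewrite /s NE (max_idPl (ltW M0)) ME.
have [|p' [v' [h1 h2 h3 h4 h5]]] := HC p v v0; first by rewrite -ME.
by apply: (Hc p' v') => //; rewrite sE.
Qed.

Lemma violation_rate {R : realType} (a g : R) : 0 < a -> 0 < g ->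
  exists2 C : R, 0 <= C & forall p v c L : R, 0 <= L ->
  let s := C * (Num.max (excess a (p - g) v) 0 + Num.max (excess a (- p) (- v)) 0) in
  (forall p' v', 0 < v' -> 0 <= p' -> p' - g + v' ^+ 2 / (2 * a) = 0 ->
     `|p - p'| <= s -> `|v - v'| <= s -> c <= - a + L * s) ->
  (forall p' v', v' < 0 -> p' <= g -> - p' + v' ^+ 2 / (2 * a) = 0 ->
     `|p - p'| <= s -> `|v - v'| <= s -> a - L * s <= c) ->
  2 * Num.max (excess a (p - g) v) 0 * (v + Num.max v 0 / a * c) +
  2 * Num.max (excess a (- p) (- v)) 0 * (- v + Num.max (- v) 0 / a * - c) <=
  4 * (`|v| / a * (L * C)) * violation a g p v.
Proof.
move=> a0 g0; have [C C0 HC] := violation_rate_upper a g a0 g0.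
exists C => // p v c L L0 s Hu Hl.
have Hu' := HC p v c L L0 Hu.
have Hl' : Num.max (excess a (- p) (- v)) 0 * (- v + Num.max (- v) 0 / a * - c) <=
    Num.max (excess a (- p) (- v)) 0 * (`|v| / a * (L * s)).
  (* The reflection of (p, v, c) into (g - p, - v, - c) exchanges the two constraints. *)
  have := HC (g - p) (- v) (- c) L L0.
  have -> : g - p - g = - p by ring.
  rewrite opprK opprB [Num.max (excess a (- p) (- v)) 0 + _]addrC -/s normrN; apply.
  move=> p' v' v'0 p'0 e h1 h2.
  suff : a - L * s <= c by lra.
  apply: (Hl (g - p') (- v')).
  - by rewrite oppr_lt0.
  - by rewrite gerDl oppr_le0.
  - by rewrite sqrrN -e; ring.
  - by rewrite distrC (_ : g - p' - p = g - p - p')//; ring.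
  - by rewrite distrC addrC.
rewrite /violation.
have m0 (y : R) : 0 <= Num.max y 0 by rewrite le_max lexx orbT.
have k0 : 0 <= `|v| / a by rewrite divr_ge0// ltW.
have kL : 0 <= `|v| / a * (L * C) by rewrite mulr_ge0// mulr_ge0.
move: Hu' Hl'; rewrite /s.
set X := Num.max (excess a (p - g) v) 0; set Y := Num.max (excess a (- p) (- v)) 0.
move: (v + _) (- v + _) => x y Hu' Hl'.
(* This turns 2 (X + Y)^2 into at most 4 (X^2 + Y^2), which is where the constant 4 comes from. *)
have sq : 0 <= `|v| / a * (L * C) * (X - Y) ^+ 2 by rewrite mulr_ge0// sqr_ge0.
apply: (@le_trans _ _ (2 * (`|v| / a * (L * C)) * (X + Y) ^+ 2)); last lra.
lra.
Qed.

(** The supremum of the zeros is a zero: otherwise uniform continuity would exclude zeros near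
    it. *)
Lemma last_zero {R : realType} (a b : R) (f : R -> R) :
  a <= b -> absolutely_continuous a b f -> f a = 0 ->
  exists2 c, a <= c <= b & f c = 0 /\ forall t, c < t -> t <= b -> f t <> 0.
Proof.
move=> ab acf fa.
pose Z := [set t | a <= t <= b /\ f t = 0].
have Za : Z a by split => //; rewrite lexx.
have supZ : has_sup Z by split; [exists a|exists b => s [/andP[]]].
have ac : a <= sup Z by exact: sup_upper_bound.
have cb : sup Z <= b by apply: ge_sup; [exists a|move=> s [/andP[]]].
exists (sup Z); first by rewrite ac.
split; last first.
  move=> t ct tb ft; have : t <= sup Z.
    by apply: sup_upper_bound => //; split=> //; rewrite tb (le_trans ac)// ltW.
  by rewrite leNgt ct.
apply/eqP; rewrite -normr_eq0; apply/negPn/negP => fc0.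
have {}fc0 : 0 < `|f (sup Z)| by rewrite lt_neqAle eq_sym fc0 normr_ge0.
have [d d0 dP] := ac_uniform _ _ _ acf _ fc0.
have [s Zs sd] := sup_adherent d0 supZ.
have sc : s <= sup Z by exact: sup_upper_bound.
have [sab fs] := Zs.
have := dP (sup Z) s; rewrite fs subr0 ltxx ac cb sab => /(_ isT isT).
by rewrite ger0_norm ?subr_ge0// ltrBlDr -ltrBlDl => /(_ sd).
Qed.

(** * Linking the original data to the violation, and the theorem *)

Lemma has_derivative_withinB {R : realType} (D : set R) (f g : R -> R) (t df dg : R) :
  has_derivative_within D f t df -> has_derivative_within D g t dg ->
  has_derivative_within D (fun s => f s - g s) t (df - dg).
Proof.
move=> hf hg; rewrite /has_derivative_within.
rewrite [X in X @ _ --> _](_ : _ =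
    fun s => (f s - f t) / (s - t) - (g s - g t) / (s - t)).
  exact: cvgB.
by apply/funext => s; rewrite -mulrBl; congr (_ / _); ring.
Qed.

Lemma safe_set_violation {R : realType} (a : R) (lub llb dl : R -> R) (t g : R)
    (x : R * R) :
  0 < a -> lub t - llb t = g ->
  safe_set a lub llb dl t x <-> violation a g (x.1 - llb t) (x.2 - dl t) = 0.
Proof.
move=> a0 <-; rewrite violation_eq0 /excess.
have -> : x.1 - llb t - (lub t - llb t) = x.1 - lub t by ring.
exact: safe_setP.
Qed.

Lemma upper_boundary_violation {R : realType} (a g p v : R) :
  0 < v -> 0 <= p -> p - g + v ^+ 2 / (2 * a) = 0 -> violation a g p v = 0.
Proof.
move=> v0 p0 e; apply/violation_eq0; rewrite /excess.
have nv : - v <= 0 by rewrite oppr_le0 ltW.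
by rewrite (max_idPl (ltW v0)) (max_idPr nv) e expr0n mul0r addr0 oppr_le0.
Qed.

Lemma lower_boundary_violation {R : realType} (a g p v : R) :
  v < 0 -> p <= g -> - p + v ^+ 2 / (2 * a) = 0 -> violation a g p v = 0.
Proof.
move=> v0 p0 e; apply/violation_eq0; rewrite /excess.
have nv : 0 <= - v by rewrite oppr_ge0 ltW.
by rewrite (max_idPr (ltW v0)) (max_idPl nv) sqrrN e expr0n mul0r addr0 subr_le0.
Qed.

Theorem theorem4 (R : realType)
    (t0 wmax ulb uub ddlmax amax alpha_ub alpha_lb : R)
    (lub llb dl ddl : R -> R)
    (wmax_ge0 : 0 <= wmax)
    (ulb_le_uub : ulb <= uub)
    (llb_le_lub : forall t, t0 <= t -> llb t <= lub t)
    (lub_dl : forall t, t0 <= t ->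
       has_derivative_within `[t0, +oo[ lub t (dl t))
    (llb_dl : forall t, t0 <= t ->
       has_derivative_within `[t0, +oo[ llb t (dl t))
    (dl_ddl : forall t, t0 <= t ->
       has_derivative_within `[t0, +oo[ dl t (ddl t))
    (ddl_bound : forall t, t0 <= t -> `|ddl t| <= ddlmax)
    (amax_gt0 : 0 < amax)
    (amax_bound :
       Num.max (ulb + wmax + ddlmax) (- uub + wmax + ddlmax) <= - amax)
    (gap_gt0 : 0 < lub t0 - llb t0)
    (alpha_ub_gt0 : 0 < alpha_ub)
    (alpha_lb_gt0 : 0 < alpha_lb)
    (alpha_eq : alpha_ub = alpha_lb)
    (alpha_ge :
       2 * wmax * Num.sqrt (2 / ((lub t0 - llb t0) * amax)) <= alpha_lb) :
  (forall (t : R) (x : R * R), t0 <= t ->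
     safe_set amax lub llb dl t x ->
     U_c amax wmax ulb uub alpha_ub alpha_lb lub llb dl ddl t x !=set0)
  /\
  (forall u : R -> R * R -> R,
     locally_lipschitz_state t0 u ->
     (forall x : R * R, piecewise_continuous_from t0 (fun t => u t x)) ->
     (forall (t : R) (x : R * R), t0 <= t ->
        safe_set amax lub llb dl t x ->
        U_c amax wmax ulb uub alpha_ub alpha_lb lub llb dl ddl t x (u t x)) ->
     forward_invariant t0 wmax u (safe_set amax lub llb dl)).
Proof.
set g := lub t0 - llb t0 in gap_gt0 alpha_ge.
(* Equal derivatives make the gap Lipschitz with constant 0. *)
have gapE t : t0 <= t -> lub t - llb t = g.
  move=> tt; have : `|(lub t - llb t) - (lub t0 - llb t0)| <= 0 * (t - t0).
    apply: (has_derivative_within_lipschitz t0 t 0 (fun s => lub s - llb s)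
      (fun=> 0)) => // s ts; last by rewrite normr0.
    rewrite -(subrr (dl s)); apply: has_derivative_withinB; first exact: lub_dl.
    exact: llb_dl.
  by rewrite mul0r normr_le0 subr_eq0 => /eqP.
split=> [t x tt xS|].
  rewrite alpha_eq.
  by apply: (control_set_nonempty _ _ _ ddlmax) xS; rewrite ?gapE//; exact: ddl_bound.
move=> u lipu _ Uu w _ wb J x iJ Jt0 Jsub [acx aex] x0S t1 Jt1.
have t01 : t0 <= t1 by have /= := Jsub _ Jt1; rewrite in_itv/= andbT.
have [acx1 acx2] := acx _ _ t01 Jt0 Jt1.
have acdl : absolutely_continuous t0 t1 dl.
  apply: (ac_lipschitz _ _ ddlmax) => a b.
  apply: (has_derivative_within_lipschitz _ _ _ dl ddl) => //.
  by move=> t /andP[tt _]; exact: ddl_bound.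
have [D HD] := ac_bounded _ _ _ acdl.
have acllb : absolutely_continuous t0 t1 llb.
  apply: (ac_lipschitz _ _ D) => a b.
  exact: (has_derivative_within_lipschitz _ _ _ llb dl).
pose p t := (x t).1 - llb t; pose v t := (x t).2 - dl t.
have acB f h : absolutely_continuous t0 t1 f -> absolutely_continuous t0 t1 h ->
    absolutely_continuous t0 t1 (fun t => f t - h t).
  move=> acf /(acZ _ _ (-1)) ach.
  rewrite [X in absolutely_continuous _ _ X](_ : _ = fun t => f t + -1 * h t).
    exact: acD.
  by apply/funext => t; rewrite mulN1r.
have acp : absolutely_continuous t0 t1 p by exact: acB.
have acv : absolutely_continuous t0 t1 v by exact: acB.
pose f t := violation amax g (p t) (v t).
have acf : absolutely_continuous t0 t1 f by exact: ac_violation.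
have safeE t y : t0 <= t -> safe_set amax lub llb dl t y <->
    violation amax g (y.1 - llb t) (y.2 - dl t) = 0.
  by move=> tt; apply: safe_set_violation => //; exact: gapE.
have aepv : {ae (@lebesgue_measure R), forall t, t0 < t < t1 ->
    is_derive t 1 p (v t) /\ is_derive t 1 v (u t (x t) + w t - ddl t)}.
  apply: negligibleS aex; apply: subsetC => t H /andP[tt tt1].
  have [|h1 h2] := H; first by apply: (iJ t0 t1) => //; rewrite !ltW.
  split; apply: is_deriveB.
    exact: (has_derivative_within_is_derive t0 _ _ _ tt (llb_dl _ (ltW tt))).
  exact: (has_derivative_within_is_derive t0 _ _ _ tt (dl_ddl _ (ltW tt))).
(* If the last zero c of f is t1, the state there is safe; otherwise a contradiction is sought just
   after c. *)
have [c /andP[t0c ct1] [fc fnz]] := last_zero _ _ _ t01 acf ((safeE _ _ (lexx _)).1 x0S).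
apply/(safeE _ _ t01); move: ct1; rewrite le_eqVlt => /predU1P[<-//|ct1].
exfalso.
have [r [L [r0 lipL]]] := lipu t1 (x c) t01.
have [C C0 HC] := violation_rate amax g amax_gt0 gap_gt0.
have [B HB] := ac_bounded _ _ _ acv.
have B0 : 0 <= B by apply: le_trans (HB c _) => //; rewrite t0c ltW.
(* The rate from [violation_rate], with |v| <= B. The absolute value is taken because the sign of L
   is not known. *)
pose k := 4 * (B / amax * (`|L| * C)).
have k0 : 0 <= k by rewrite mulr_ge0// mulr_ge0// ?divr_ge0 ?mulr_ge0// ltW.
(* If the two positive parts sum to less than e, then s = C (X + Y) < r / 2; this holds once f < e^2
   / 2. The added 1 covers C = 0. *)
pose e := r / 2 / (C + 1).
have e0 : 0 < e by rewrite !divr_gt0// ltr_wpDl.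
have r20 : 0 < r / 2 by rewrite divr_gt0.
have [d1 d10 Hd1] := ac_uniform _ _ _ acf _ (divr_gt0 (exprn_gt0 2 e0) (ltr0Sn R 1)).
have [d2 d20 Hd2] := ac_uniform _ _ _ acx1 _ r20.
have [d3 d30 Hd3] := ac_uniform _ _ _ acx2 _ r20.
have [T [cT Tt1 [Td1 Td2 Td3 Tk]]] : exists T, [/\ c < T, T <= t1 &
    [/\ T - c < d1, T - c < d2, T - c < d3 & k * (T - c) < 1]].
  have ck : 0 < (k + 1)^-1 by rewrite invr_gt0 ltr_wpDl.
  have Tc z : 0 < z -> \forall T \near c^'+, T - c < z.
    by move=> z0; near=> T; rewrite ltrBlDl; near: T; apply: nbhs_right_lt; rewrite ltrDl.
  near c^'+ => T; exists T; split.
  - by [].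
  - by near: T; exact: nbhs_right_le.
  split; [by near: T; exact: Tc|by near: T; exact: Tc|by near: T; exact: Tc|].
  have : T - c < (k + 1)^-1 by near: T; exact: Tc.
  rewrite -[(k + 1)^-1]mul1r ltr_pdivlMr ?ltr_wpDl// mulrC; apply: le_lt_trans.
  by rewrite ler_wpM2r ?lerDl// subr_ge0 ltW.
(* With this rate almost everywhere, [ac_gronwall] on [c, T] yields f T = 0, against the choice of
   c. *)
suff Hf (t : R) : c < t -> t < T -> is_derive t 1 p (v t) ->
    is_derive t 1 v (u t (x t) + w t - ddl t) ->
    exists2 d, is_derive t 1 f d & d <= k * f t.
  apply: (fnz T) => //.
  have cT' := ltW cT.
  apply: (ac_gronwall c T k f k0 Tk cT' _ _ fc) => //; last by rewrite lexx cT'.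
  - exact: ac_subitv acf.
  - by move=> t; exact: violation_ge0.
  apply: negligibleS aepv; apply: subsetC => t H /andP[ct tT].
  have [|hp hv] := H; last exact: Hf.
  by rewrite (le_lt_trans t0c ct) (lt_le_trans tT).
move=> ct tT hp hv.
have tt0 : t0 <= t by rewrite (le_trans t0c)// ltW.
have t01t : t0 <= t <= t1 by rewrite tt0 (le_trans (ltW tT)).
have c01 : t0 <= c <= t1 by rewrite t0c ltW.
eexists; first exact: (is_derive_violation amax g _ _ _ _ _ hp hv).
have near_c d : T - c < d -> `|c - t| < d.
  by move=> Td; rewrite ltr0_norm ?subr_lt0// opprB (lt_trans _ Td)// ltrD2r.
have := HC (p t) (v t) (u t (x t) + w t - ddl t) `|L| (normr_ge0 _).
set s := C * _ => Hs.
have sr : s < r / 2.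
  have := Hd1 _ _ c01 t01t (near_c _ Td1).
  rewrite fc sub0r normrN ger0_norm ?violation_ge0// /f /violation.
  move: @s {Hs}; set X := Num.max _ 0; set Y := Num.max _ 0 => s XY.
  have X0 : 0 <= X by rewrite le_max lexx orbT.
  have Y0 : 0 <= Y by rewrite le_max lexx orbT.
  have XYe : X + Y < e.
    rewrite -ltr_sqr ?nnegrE ?addr_ge0 ?(ltW e0)//.
    have := sqr_ge0 (X - Y); lra.
  apply: (@le_lt_trans _ _ (C * e)); first by rewrite /s ler_wpM2l// ltW.
  have <- : (C + 1) * e = r / 2 by rewrite /e mulrC divfK// lt0r_neq0// ltr_wpDl.
  by rewrite mulrDl mul1r ltrDl.
(* The state x t is within r / 2 of x c, and the comparison state is less than r / 2 further away,
   so both lie in the ball where u is Lipschitz. *)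
have Hlip p' v' : `|p t - p'| <= s -> `|v t - v'| <= s ->
    `|u t (x t) - u t (p' + llb t, v' + dl t)| <= `|L| * s.
  move=> ps vs.
  have x1s : `|(x t).1 - (p' + llb t)| <= s.
    by rewrite [X in `|X|](_ : _ = p t - p')// /p; ring.
  have x2s : `|(x t).2 - (v' + dl t)| <= s.
    by rewrite [X in `|X|](_ : _ = v t - v')// /v; ring.
  have x1c := Hd2 _ _ c01 t01t (near_c _ Td2).
  have x2c := Hd3 _ _ c01 t01t (near_c _ Td3).
  have s0 : 0 <= s by exact: le_trans ps.
  have r2r : r / 2 < r by rewrite ltr_pdivrMr// ltr_pMr// ltr1n.
  have split_r : r = r / 2 + r / 2 by exact: splitr.
  have := lipL t t01t (x t, (p' + llb t, v' + dl t)) => /= /(_ _) H.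
  apply: (le_trans (H _)).
    split; split => /=.
    - exact: lt_trans x1c r2r.
    - exact: lt_trans x2c r2r.
    - rewrite /ball/= -(subrKA (x t).1) split_r (le_lt_trans (ler_normD _ _))//.
      by rewrite ltrD// (le_lt_trans x1s).
    - rewrite /ball/= -(subrKA (x t).2) split_r (le_lt_trans (ler_normD _ _))//.
      by rewrite ltrD// (le_lt_trans x2s).
  apply: (@le_trans _ _ (`|L| * `|x t - (p' + llb t, v' + dl t)|)).
    by rewrite ler_wpM2r// ler_norm.
  by rewrite ler_wpM2l// prod_normE ge_max x1s x2s.
have /andP[w1 w2] := wb t tt0.
(* The state x t is outside the safe set, where [Uu] says nothing; the control condition is read at
   the comparison state and carried over by [Hlip]. *)
have safe' p' v' : violation amax g p' v' = 0 ->
    U_c amax wmax ulb uub alpha_ub alpha_lb lub llb dl ddl t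
      (p' + llb t, v' + dl t) (u t (p' + llb t, v' + dl t)).
  by move=> V; apply: Uu => //; apply/safeE => //=; rewrite !addrK.
(* In both boundary cases the margin [wmax] in the control bound absorbs w t, leaving the
   deceleration [amax] up to |L| s. *)
apply: le_trans (Hs _ _) _.
- move=> p' v' v'0 p'0 e' ps vs.
  have Us := safe' _ _ (upper_boundary_violation _ _ _ _ v'0 p'0 e').
  have := Hlip _ _ ps vs; rewrite ler_norml => /andP[_ h].
  have := control_le_upper_boundary _ _ _ _ _ _ _ _ _ _ _ _ _ _ _ Us.
  rewrite /= addrK ltrDr => /(_ v'0).
  rewrite (_ : p' + llb t - lub t = p' - g); last by rewrite -(gapE _ tt0); ring.
  move=> /(_ e'); lra.
- move=> p' v' v'0 p'0 e' ps vs.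
  have Us := safe' _ _ (lower_boundary_violation _ _ _ _ v'0 p'0 e').
  have := Hlip _ _ ps vs; rewrite ler_norml => /andP[h _].
  have := control_ge_lower_boundary _ _ _ _ _ _ _ _ _ _ _ _ _ _ _ Us.
  rewrite /= !addrK gtrDr => /(_ v'0 e'); lra.
- rewrite ler_wpM2r ?violation_ge0// /k ler_wpM2l// ler_wpM2r ?mulr_ge0//.
  by apply: ler_wpM2r; [rewrite invr_ge0 ltW|exact: HB].
Unshelve. all: by end_near. Qed.
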